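(* Let $(X,\mathcal{A},\mu)$ be a measure space and let $I$ be an ideal (not necessarily proper) in $\mathcal{M}(X,\mathcal{A})$. If $\mathcal{M}(X,\mathcal{A})$ equipped with the $U_\mu^I$-topology is a topological ring, then $I\subseteq L^\infty(X,\mathcal{A},\mu)$.
   Context: $X$ is a non-empty set, $\mathcal{A}$ a $\sigma$-algebra on $X$, $\mu:\mathcal{A}\to[0,\infty]$ a measure. $\mathcal{M}(X,\mathcal{A})$ is the commutative ring of all measurable functions $X\to\mathbb{R}$ under pointwise operations. A $\mu$-null set is a set $E\in\mathcal{A}$ with $\mu(E)=0$. For an ideal $I$ of $\mathcal{M}(X,\mathcal{A})$, $f\in\mathcal{M}(X,\mathcal{A})$ and real $\epsilon>0$, put $U_\mu(f,I,\epsilon)=\{g\in\mathcal{M}(X,\mathcal{A}): g-f\in I$ and $\sup_{x\in X\setminus E}|f(x)-g(x)|<\epsilon$ for some $\mu$-null set $E\}$ (supremum taken in $[0,\infty]$). These sets form an open base of the $U_\mu^I$-topology on $\mathcal{M}(X,\mathcal{A})$. $L^\infty(X,\mathcal{A},\mu)$ denotes the set of all essentially bounded $f\in\mathcal{M}(X,\mathcal{A})$, i.e. those for which there is a $\mu$-null set $E$ such that $f$ is bounded on $X\setminus E$ (functions are not identified when equal almost everywhere). Topological rings are not assumed Hausdorff. *)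

(* Defs.v *)
From HB Require Import structures.
From mathcomp Require Import all_boot all_order all_algebra.
From mathcomp Require Import all_classical all_reals all_analysis.
From mathcomp Require Import measurable_realfun.

Set Implicit Arguments.
Unset Strict Implicit.
Unset Printing Implicit Defensive.

Import Order.TTheory GRing.Theory Num.Theory.
Import numFieldNormedType.Exports.

Local Open Scope classical_set_scope.
Local Open Scope ring_scope.

(* Unlike idealr_closed of ring_quotient, this does not exclude the whole
   ring, and membership need not be decidable. *)
Record ideal (A : comPzRingType) := Ideal {
  ideal_set :> set A;
  ideal0 : ideal_set 0;
  idealD : forall u v, ideal_set u -> ideal_set v -> ideal_set (u + v);
  idealMl : forall a u, ideal_set u -> ideal_set (a * u) }.

HB.structure Definition PreTopologicalPzRing :=
  {A of Topological A & GRing.PzRing A}.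

Definition topological_ring (A : PreTopologicalPzRing.type) : Prop :=
  [/\ continuous (fun z : A * A => z.1 + z.2),
      continuous (fun x : A => - x) &
      continuous (fun z : A * A => z.1 * z.2)].

Section null_sets.
Context d (T : measurableType d) (R : realType).
Variable mu : {measure set T -> \bar R}.

(* mu.-negligible would also allow nonmeasurable subsets of null sets. *)
Definition null_set (E : set T) : Prop := measurable E /\ mu E = 0%E.

(* The functions themselves, not classes modulo almost-everywhere equality. *)
Definition Linfty : set {mfun T >-> R} :=
  [set f | exists2 E : set T, null_set E & [bounded f x | x in ~` E]].

(* When E is the whole space the ereal_sup is -oo instead of 0; the comparison
   with a positive eps has the same truth value. *)
Definition Uball (I : ideal {mfun T >-> R}) (f : {mfun T >-> R}) (eps : R) :
    set {mfun T >-> R} :=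
  [set g | ideal_set I (g - f) /\ exists2 E : set T, null_set E &
     (ereal_sup [set `|f x - g x|%:E | x in ~` E] < eps%:E)%E].

Definition Ubase (I : ideal {mfun T >-> R}) : set (set {mfun T >-> R}) :=
  [set B | exists f eps, 0 < eps /\ B = Uball I f eps].

Arguments Ubase I : clear implicits.

Section base.
Variable I : ideal {mfun T >-> R}.

Lemma sup_lt_bound (f g : T -> R) (E : set T) (eps : R) : 0 < eps ->
  (ereal_sup [set `|f x - g x|%:E | x in ~` E] < eps%:E)%E <->
  exists2 r, r < eps & forall x, ~ E x -> `|f x - g x| <= r.
Proof.
move=> eps0; split => [|[r re fgr]]; last first.
  apply: (@le_lt_trans _ _ r%:E); last by rewrite lte_fin.
  by apply: ge_ereal_sup => _ [x Ex <-]; rewrite lee_fin; exact: fgr.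
set s := ereal_sup _ => se.
have ub x : ~ E x -> (`|f x - g x|%:E <= s)%E.
  by move=> Ex; apply: ereal_sup_ubound; exists x.
case: s se ub => [r||] //; first by rewrite lte_fin => re ub; exists r.
by move=> _ ub; exists 0 => // x /ub.
Qed.

Lemma null_setU E F : null_set E -> null_set F -> null_set (E `|` F).
Proof.
move=> [mE E0] [mF F0]; split; first exact: measurableU.
apply/eqP; rewrite -measure_le0; apply: le_trans (measureU2 _ mE mF) _.
by rewrite [X in (X + _)%E]E0 [X in (_ + X)%E]F0 adde0.
Qed.

Lemma Uball_center f eps : 0 < eps -> Uball I f eps f.
Proof.
move=> e0; split; first by rewrite subrr; exact: ideal0.
exists set0; first by split => //; exact: measure0.
by apply/sup_lt_bound => //; exists 0 => // x _; rewrite subrr normr0.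
Qed.

Lemma Uball_sub f eps h : 0 < eps -> Uball I f eps h ->
  exists2 del, 0 < del &
    forall del', 0 < del' -> del' <= del -> Uball I h del' `<=` Uball I f eps.
Proof.
move=> e0 [Ihf [E nE /(sup_lt_bound _ _ _ e0)[r re fhr]]].
exists (eps - r); first by rewrite subr_gt0.
move=> del d0 dle g [Igh [F nF /(sup_lt_bound _ _ _ d0)[q qd hgq]]]; split.
  by rewrite -(subrKA h); exact: idealD.
exists (E `|` F); first exact: null_setU.
apply/sup_lt_bound => //; exists (r + q).
  by rewrite addrC -ltrBrDr (lt_le_trans qd).
move=> x /not_orP[Ex Fx]; rewrite -(subrKA (h x)).
by rewrite (le_trans (ler_normD _ _))// lerD ?fhr ?hgq.
Qed.

Lemma Ubase_cover : \bigcup_(B in Ubase I) B = setT.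
Proof.
apply/seteqP; split => // f _; exists (Uball I f 1); last exact: Uball_center.
by exists f, 1.
Qed.

Lemma Ubase_join (B C : set {mfun T >-> R}) (h : {mfun T >-> R}) :
  Ubase I B -> Ubase I C -> B h -> C h ->
  exists K, [/\ Ubase I K, K h & K `<=` B `&` C].
Proof.
move=> [f [a [a0 ->]]] [g [b [b0 ->]]].
move=> /(Uball_sub a0)[p p0 pf] /(Uball_sub b0)[q q0 qg].
have m0 : 0 < Num.min p q by rewrite lt_min p0.
exists (Uball I h (Num.min p q)); split.
- by exists h, (Num.min p q).
- exact: Uball_center.
- by rewrite subsetI; split; [apply: pf|apply: qg]; rewrite // ge_min lexx ?orbT.
Qed.

End base.

End null_sets.

(* M(X, A) with the U_mu^I-topology; mu and I only serve to select the
   topological structure attached to this copy of the ring. *)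
Definition Uspace d (T : measurableType d) (R : realType)
  (mu : {measure set T -> \bar R}) (I : ideal {mfun T >-> R}) : Type :=
  {mfun T >-> R}.

Section topology.
Context d (T : measurableType d) (R : realType).
Variables (mu : {measure set T -> \bar R}) (I : ideal {mfun T >-> R}).

HB.instance Definition _ := GRing.ComNzRing.on (Uspace mu I).

HB.instance Definition _ := isBaseTopological.Build (Uspace mu I)
  (Ubase_cover mu I) (@Ubase_join d T R mu I).

End topology.

(* Main.v *)
(** Multiplication by [1 + f ^ 2] is continuous at [0], so it sends some basic
    neighbourhood [Uball I 0 eps] into [Uball I 0 1].  That neighbourhood
    contains [c * f / (1 + f ^ 2)] for small [c > 0], since this function lies
    in [I] with [f] and [`|f / (1 + f ^ 2)| <= 1].  Hence the product [c * f]
    is bounded by [1] off a null set. *)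
From HB Require Import structures.
Require Import Defs.
From mathcomp Require Import all_boot all_order all_algebra.
From mathcomp Require Import all_classical all_reals all_analysis.
From mathcomp Require Import measurable_realfun.
From mathcomp Require Import lra.

Set Implicit Arguments.
Unset Strict Implicit.
Unset Printing Implicit Defensive.

Import Order.TTheory GRing.Theory Num.Theory.
Import numFieldNormedType.Exports.

Local Open Scope classical_set_scope.
Local Open Scope ring_scope.

Lemma oneDsqr_gt0 (R : realType) (x : R) : 0 < oneDsqr x.
Proof. exact: lt_le_trans ltr01 (oneDsqr_ge1 x). Qed.

(** Clearing the positive denominator leaves [|x| <= 1 + x ^ 2], and both [1 + x ^ 2 - x] and
    [1 + x ^ 2 + x] are positive. *)
Lemma norm_oneDsqrV_mul_le1 (R : realType) (x : R) :
  `|(oneDsqr x)^-1 * x| <= 1.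
Proof.
rewrite normrM normfV (gtr0_norm (oneDsqr_gt0 x)) mulrC.
rewrite ler_pdivrMr ?oneDsqr_gt0// mul1r ler_norml /oneDsqr.
by apply/andP; split; nra.
Qed.

Section Utopology.
Context d (T : measurableType d) (R : realType).
Implicit Types (f g : {mfun T >-> R}) (mu : {measure set T -> \bar R}).

(** Composing [f] with a continuous, hence Borel, function keeps it measurable; this makes the
    reciprocal available as a ring element. *)
Lemma mfun_oneDsqrV f :
  exists k : {mfun T >-> R}, forall x, k x = (oneDsqr (f x))^-1.
Proof.
have mk : measurable_fun setT ((fun y : R => (oneDsqr y)^-1) \o f).
  apply: measurableT_comp => //.
  apply: continuous_measurable_fun => y.
  exact: continuous_oneDsqrV.
pose kM := isMeasurableFun.Build _ _ _ _ _ mk.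
by exists (HB.pack_for {mfun T >-> R} (fun x => (oneDsqr (f x))^-1) kM).
Qed.

Lemma nbhs_Uball mu (I : ideal {mfun T >-> R}) (f : Uspace mu I) eps :
  0 < eps -> nbhs f (Uball mu I f eps).
Proof.
move=> e0; apply: open_nbhs_nbhs; split; last exact: Uball_center.
exists [set Uball mu I f eps]; last by rewrite bigcup_set1.
by move=> _ ->; exists f, eps.
Qed.

(** A basic open set around [f] may be centred at another [g]; [Uball_sub] recentres it at [f]. *)
Lemma nbhs_UballP mu (I : ideal {mfun T >-> R}) (f : Uspace mu I)
    (A : set (Uspace mu I)) :
  nbhs f A -> exists2 eps, 0 < eps & Uball mu I f eps `<=` A.
Proof.
rewrite nbhsE => -[B [[D' D'U <-] [C D'C Cf]] BA].
have [g [eps [e0 CE]]] := D'U _ D'C.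
move: Cf; rewrite CE => /(Uball_sub e0)[del del0 delU].
exists del => // h /(delU _ del0 (lexx _)) gh; apply: BA.
by exists C => //; rewrite CE.
Qed.

(** Off [E] one has [|c * f x| <= r], so [r / c] bounds [f] there. *)
Lemma Linfty_scale mu f (c : R) g eps : 0 < c -> 0 < eps ->
  (forall x, g x = c * f x) ->
  (exists2 E, Defs.null_set mu E &
    (ereal_sup [set `|0 - g x|%:E | x in ~` E] < eps%:E)%E) ->
  Linfty mu f.
Proof.
move=> c0 e0 gE [E nE /(sup_lt_bound (cst 0) g E e0)[r _ gr]]; exists E => //.
exists (r / c); split => [|M rM x Ex /=]; first exact: num_real.
apply: le_trans (ltW rM).
by rewrite ler_pdivlMr// mulrC -(gtr0_norm c0) -normrM -gE -normrN -sub0r gr.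
Qed.

End Utopology.

Theorem theorem2p4 (d : measure_display) (T : measurableType d) (R : realType)
    (mu : {measure set T -> \bar R}) (I : ideal {mfun T >-> R}) :
  topological_ring (Uspace mu I) -> I `<=` Linfty mu.
Proof.
move=> [_ _ mulC] f If.
pose g : Uspace mu I := (1 + f ^+ 2 : {mfun T >-> R}).
have [[A B] /= [nA nB] ABU] :
    nbhs (g, 0 : Uspace mu I) [set z | Uball mu I 0 1 (z.1 * z.2)].
  apply: mulC; rewrite /= mulr0.
  exact: (@nbhs_Uball _ _ _ mu I 0).
have [eps e0 epsB] := nbhs_UballP nB.
have [k kE] := mfun_oneDsqrV f.
(* Halving [eps] makes the supremum of [|h|] strictly smaller than [eps]; the factor [f] puts [h] in
   [I]. *)
pose h : {mfun T >-> R} := cst (eps / 2) * k * f.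
have e20 : 0 < eps / 2 by rewrite divr_gt0.
have Bh : B h.
  apply: epsB; split; first by rewrite subr0; exact: idealMl.
  exists set0; first by split => //; exact: measure0.
  apply/sup_lt_bound => //; exists (eps / 2).
    by rewrite gtr_pMr// invf_lt1// ltr1n.
  move=> x _; rewrite sub0r normrN /= -mulrA kE normrM (gtr0_norm e20).
  by rewrite ler_piMr ?(ltW e20)// norm_oneDsqrV_mul_le1.
(* The first factor stays fixed at [g], so of [A] only [g] itself enters. *)
have [_ ghU] := ABU (g, h : Uspace mu I) (conj (nbhs_singleton nA) Bh).
apply: (@Linfty_scale _ _ _ mu f (eps / 2) (g * h) 1) ghU => // x.
have -> : (g * h : {mfun T >-> R}) x =
    oneDsqr (f x) * (eps / 2 * k x * f x) by [].
by rewrite kE -mulrA mulrCA mulVKf// gt_eqF// oneDsqr_gt0.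
Qed.
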